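(* Let $k=6$, $4$, or $3$, let $\zeta_k=e^{2\pi i/k}$ and $\epsilon_k:=(1+\zeta_k)^{-1}$. Let $A$ be the Hermitian area form on $\mathbb{C}^{2k-2}$ with coordinates $(v_1,\dots,v_{2k-2})$ described in the context, and put $x_i=\sum_{j\le i}v_j$ for $i=1,\dots,2k-2$. The Gram matrix of $A$ in the coordinates $(x_1,\dots,x_{2k-2})$ is $$\mathrm{Im}\,\zeta_k\begin{pmatrix}-1&\epsilon_k&0&\cdots&0\\ \overline{\epsilon}_k&-1&\epsilon_k&\cdots&0\\0&\overline{\epsilon}_k&-1&\cdots&0\\ \vdots&\vdots&\vdots&&\vdots\\0&0&0&\cdots&-1\end{pmatrix}$$ (the tridiagonal matrix with diagonal entries $-1$, entries $\epsilon_k$ just above the diagonal and $\overline{\epsilon}_k$ just below it, multiplied by $\mathrm{Im}\,\zeta_k$).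
   Context: Hermitian forms are conjugate-linear in the first variable, so a Gram matrix $G$ corresponds to $A(x,y)=\sum_{i,j}\overline{x}_iG_{ij}y_j$. Definition of $A$. Let $M$ be an oriented sphere with a flat metric having $2k$ cone points $p_1,\dots,p_{2k}$, each of cone angle $2\pi-2\pi/k$. For $j=1,\dots,2k-1$ let $\gamma_j$ be a shortest path from $p_{2k}$ to $p_j$, the labels being chosen so that the $\gamma_j$ are cyclically ordered clockwise about $p_{2k}$. The complement of $\bigcup_j\gamma_j$ embeds isometrically (uniquely up to rotation and translation) in $\mathbb{C}$ as the interior of a polygon $\mathcal{P}_M$. Each $\gamma_j$ gives a pair of adjacent edges of $\mathcal{P}_M$, which regarded as directed edges are complex numbers $v_j,w_j$, placed end-to-end in order $v_1,w_1,v_2,w_2,\dots,v_{2k-1},w_{2k-1}$ going around the polygon, and they satisfy $w_j=-\zeta_kv_j$ and $\sum_{j=1}^{2k-1}(v_j+w_j)=0$. Hence $v_1,\dots,v_{2k-2}$ determine $\mathcal{P}_M$ and $M$, and a small deformation of $(v_1,\dots,v_{2k-2})\in\mathbb{C}^{2k-2}$ gives a small deformation of $M$. The area of $M$ (equivalently of $\mathcal{P}_M$) is the restriction to such vectors of a quadratic form, and $A$ is the unique Hermitian form on $\mathbb{C}^{2k-2}$ with $A(v,v)=\mathrm{area}(M)$ for all such $v=(v_1,\dots,v_{2k-2})$. Explicitly, the area of $M$ is the signed area of the outer polygon with successive vertices $(1-\zeta_k)x_0,(1-\zeta_k)x_1,\dots,(1-\zeta_k)x_{2k-2}$, with $x_0=0$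 (where $(1-\zeta_k)x_i=\sum_{j\le i}(v_j+w_j)$), minus the sum over $j=1,\dots,2k-1$ of the areas of the triangles with edges $v_j$ and $w_j$. *)

(* Defs.v *)
From HB Require Import structures.
From mathcomp Require Import all_boot all_order all_algebra.
From mathcomp Require Import all_classical all_reals all_analysis.
From mathcomp Require Import complex.

Set Implicit Arguments.
Unset Strict Implicit.
Unset Printing Implicit Defensive.

Import Order.TTheory GRing.Theory Num.Theory.
Import numFieldNormedType.Exports.

Local Open Scope ring_scope.
Local Open Scope complex_scope.

Definition zeta (R : realType) (k : nat) : R[i] :=
  cos (2 * pi / k%:R) +i* sin (2 * pi / k%:R).

Definition epsilon (R : realType) (k : nat) : R[i] := (1 + zeta R k)^-1.

(* The edges v_1, ..., v_{2k-1} of the polygon determined by v_1, ..., v_{2k-2}.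
   Since w_j = - zeta v_j with zeta <> 1, the closing relation
   \sum_j (v_j + w_j) = 0 says that v_{2k-1} = - (v_1 + ... + v_{2k-2}).
   Indices are shifted: row j is the edge v_{j+1}. *)
Definition v_edge (R : realType) (k : nat) (v : 'cV[R[i]]_(2 * k - 2)) :
    'cV[R[i]]_(2 * k - 2 + 1) :=
  col_mx v (const_mx (- \sum_j v j 0)).

Definition w_edge (R : realType) (k : nat) (v : 'cV[R[i]]_(2 * k - 2)) :
    'cV[R[i]]_(2 * k - 2 + 1) :=
  - zeta R k *: v_edge v.

(* The sum of v_j + w_j over 1 <= j <= i, that is (1 - zeta) x_i, for
   i = 0, ..., 2k-2 (row j carries the label j+1, hence the strict bound). *)
Definition outer_vertex (R : realType) (k : nat) (v : 'cV[R[i]]_(2 * k - 2))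
    (i : 'I_(2 * k - 2 + 1)) : R[i] :=
  \sum_(j < 2 * k - 2 + 1 | (j < i)%N) (v_edge v j 0 + w_edge v j 0).

(* Shoelace formula, positive for counterclockwise polygons; ordS is the cyclic
   successor. *)
Definition signed_area (R : realType) (m : nat) (z : 'I_m -> R[i]) : R :=
  2^-1 * \sum_(i < m) complex.Im ((z i)^* * z (ordS i)).

Definition triangle_area (R : realType) (a b : R[i]) : R :=
  2^-1 * `|complex.Im (a^* * b)|.

(* The area of the flat cone sphere (equivalently, of its cut-open polygon)
   with edge vectors v_1, ..., v_{2k-2}. *)
Definition area (R : realType) (k : nat) (v : 'cV[R[i]]_(2 * k - 2)) : R :=
  signed_area (outer_vertex v)
  - \sum_(j < 2 * k - 2 + 1) triangle_area (v_edge v j 0) (w_edge v j 0).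

Definition x_coord (R : realType) (n : nat) (v : 'cV[R[i]]_n) : 'cV[R[i]]_n :=
  \col_i \sum_(j < n | (j <= i)%N) v j 0.

Definition is_gram_matrix (R : realType) (n : nat)
    (A : 'cV[R[i]]_n -> 'cV[R[i]]_n -> R[i])
    (x : 'cV[R[i]]_n -> 'cV[R[i]]_n) (G : 'M[R[i]]_n) : Prop :=
  forall u v, A u v = \sum_i \sum_j (x u i 0)^* * G i j * x v j 0.

Definition tridiag_gram (R : realType) (k : nat) : 'M[R[i]]_(2 * k - 2) :=
  (complex.Im (zeta R k))%:C *:
  \matrix_(i, j) (if j == i :> nat then -1
                  else if j == i.+1 :> nat then epsilon R k
                  else if i == j.+1 :> nat then (epsilon R k)^*
                  else 0).

(* Main.v *)
(** With x_0 = x_(2k-1) = 0 and v_j = x_j - x_(j-1), the shoelace formula and the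
    triangle areas express the area through c = Re zeta and s = Im zeta as
      (1 - c) \sum Im (x_i^* x_(i+1)) + s \sum Re (x_i^* x_(i+1)) - s \sum |x_i|^2,
    and s epsilon = (s - i (1 - c)) / 2 because c^2 + s^2 = 1, so this is the
    quadratic form of the tridiagonal matrix.  A sesquilinear form whose diagonal
    vanishes on an open set is zero: for u0 in the interior and t small, adding
    its values at u0 + t h and u0 - t h isolates |t|^2 D(h, h), and then one
    polarizes. *)
Require Import Defs.
From HB Require Import structures.
From mathcomp Require Import all_boot all_order all_algebra.
From mathcomp Require Import all_classical all_reals all_analysis.
From mathcomp Require Import complex.
From mathcomp Require Import ring lra zify.

Import Order.TTheory GRing.Theory Num.Theory.
Import numFieldNormedType.Exports.

Local Open Scope ring_scope.
Local Open Scope complex_scope.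

(** * Uniqueness of a form with prescribed diagonal *)

Lemma sesquilinear_eq0 (R : realType) (n : nat)
    (D : 'cV[R[i]]_n -> 'cV[R[i]]_n -> R[i])
    (DDl : forall u u' v, D (u + u') v = D u v + D u' v)
    (DDr : forall u v v', D u (v + v') = D u v + D u v')
    (DZl : forall a u v, D (a *: u) v = a^* * D u v)
    (DZr : forall a u v, D u (a *: v) = a * D u v)
    (U : set 'cV[R[i]^o]_n) :
  (interior U !=set0)%classic -> (forall v : 'cV[R[i]]_n, U v -> D v v = 0) ->
  forall u v, D u v = 0.
Proof.
move=> [u0 /nbhs_ballP[e /= e0 eU]] DU.
have DV u v : D (- u) (- v) = D u v.
  rewrite -(scaleN1r u) -(scaleN1r v) DZl DZr.
  by rewrite rmorphN rmorph1 !mulN1r opprK.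
have DNr u v : D u (- v) = - D u v by rewrite -scaleN1r DZr mulN1r.
have DNl u v : D (- u) v = - D u v by rewrite -[v]opprK DV DNr opprK.
have D0 h : D h h = 0.
  pose N := `|h : 'cV[R[i]^o]_n|.
  (* The summand 1 covers [h = 0] and makes the bound on [t *: h] strict. *)
  have N1 : 0 < 1 + N by rewrite ltr_pwDl ?normr_ge0 ?ltr01.
  pose t := e / (1 + N).
  have t0 : 0 < t by rewrite divr_gt0.
  have th : `|(t *: h : 'cV[R[i]^o]_n)| < e.
    rewrite normrZ gtr0_norm// /t -mulrA gtr_pMr// mulrC ltr_pdivrMr// mul1r.
    by rewrite ltrDr.
  have D1 : D (u0 + t *: h) (u0 + t *: h) = 0.
    by apply/DU/eU; rewrite mx_norm_ball /ball_/= opprD addNKr normrN.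
  have D2 : D (u0 - t *: h) (u0 - t *: h) = 0.
    by apply/DU/eU; rewrite mx_norm_ball /ball_/= opprB addrC subrK.
  have D3 : D u0 u0 = 0 by apply/DU/eU/ballxx.
  move: D1 D2; rewrite !DDl !DDr !DNl !DNr opprK D3 !add0r => D1 D2.
  have /eqP : 2 * D (t *: h) (t *: h) = 0.
    by rewrite -[RHS]addr0 -{1}D1 -D2; ring.
  clearbody t; rewrite DZl DZr !mulf_eq0 conjc_eq0 (gt_eqF t0) pnatr_eq0 /=.
  by move/eqP.
move=> u v; pose I : R[i] := 0 +i* 1.
have IC : (I^*)%R = - I by apply/eqP; rewrite eq_complex /= oppr0 !eqxx.
(* These give [D u v + D v u = 0] and [I * D u v - I * D v u = 0]; [I] times the first plus the
   second leaves [2 * I * D u v]. *)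
have h1 := D0 (u + v); have h2 := D0 (u + I *: v).
rewrite !DDl !DDr !D0 !add0r !addr0 in h1.
rewrite !DDl !DDr !DZr !DZl !D0 IC !mulr0 !add0r !addr0 in h2.
have /eqP : 2 * I * D u v = 0.
  transitivity (I * D u v + - I * D v u + I * (D u v + D v u)); first by ring.
  by rewrite h1 h2 mulr0 addr0.
rewrite !mulf_eq0 pnatr_eq0 /= => /orP[|/eqP//].
by rewrite eq_complex /= oner_eq0 andbF.
Qed.

(** * Partial sums of the edge vectors *)

Section PartialSums.
Variables (R : realType) (n : nat) (v : 'cV[R[i]]_n).

(** Extension by zero to all of [nat], so that partial sums satisfy a recursion free of bound proofs
    and include x_0 = 0. *)
Definition coef (j : nat) : R[i] := if insub j is Some o then v o 0 else 0.

Definition partial_sum (i : nat) : R[i] := \sum_(j < i) coef j.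

Lemma coefE (j : 'I_n) : coef j = v j 0.
Proof. by rewrite /coef valK. Qed.

Lemma partial_sum0 : partial_sum 0 = 0.
Proof. exact: big_ord0. Qed.

Lemma partial_sumS i : partial_sum i.+1 = partial_sum i + coef i.
Proof. exact: big_ord_recr. Qed.

Lemma partial_sum_full : partial_sum n = \sum_j v j 0.
Proof. by apply: eq_bigr => j _; rewrite coefE. Qed.

Lemma partial_sum_widen i : (i <= n)%N ->
  partial_sum i = \sum_(j < n | (j < i)%N) v j 0.
Proof.
move=> le_in; rewrite /partial_sum (big_ord_widen _ coef le_in).
by apply: eq_bigr => j _; rewrite coefE.
Qed.

Lemma x_coordE (i : 'I_n) : x_coord v i 0 = partial_sum i.+1.
Proof. by rewrite mxE partial_sum_widen. Qed.

End PartialSums.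

(** The squared modulus, valued in [R] rather than in [R[i]]. *)
Definition sqnorm (R : realType) (z : R[i]) : R := complex.Re (z^* * z).

(** * The polygon in the coordinates x_i *)

Section Area.
Variables (R : realType) (k : nat) (v : 'cV[R[i]]_(2 * k - 2)).
Let n := (2 * k - 2)%N.
Let X := partial_sum _ _ v.
Let z := zeta R k.

Lemma v_edgeE (j : 'I_(n + 1)) :
  v_edge v j 0 = if (j < n)%N then X j.+1 - X j else - X n.
Proof.
rewrite /v_edge mxE; case: splitP => i ji.
  by rewrite ji /X partial_sumS coefE addrAC subrr add0r.
by rewrite mxE /X partial_sum_full.
Qed.

Lemma w_edgeE (j : 'I_(n + 1)) : w_edge v j 0 = - z * v_edge v j 0.
Proof. by rewrite [LHS]mxE. Qed.

Lemma outer_vertexE (i : 'I_(n + 1)) : outer_vertex v i = (1 - z) * X i.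
Proof.
have lein : (i <= n)%N by rewrite -ltnS -[n.+1]addn1.
rewrite /outer_vertex /X partial_sum_widen// mulr_sumr.
rewrite big_split_ord /= [X in _ + X]big1 ?addr0; last first.
  by move=> j /= /leq_trans/(_ lein); rewrite ltnNge leq_addr.
apply: eq_bigr => j _; rewrite w_edgeE /v_edge col_mxEu.
by rewrite mulrBl mul1r mulNr.
Qed.

(** The common factor [1 - z] comes out as its squared modulus, and the side returning to vertex 0
    contributes nothing because [X 0 = 0]. *)
Lemma signed_areaE : signed_area (outer_vertex v) =
  2^-1 * sqnorm _ (1 - z) * \sum_(i < n) complex.Im ((X i)^* * X i.+1).
Proof.
rewrite /signed_area -mulrA; congr (_ * _).
under eq_bigr => i _ do rewrite !outer_vertexE /=.
rewrite big_split_ord /= big_ord1 /= addn0 addn1 modnn.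
rewrite [X 0%N]partial_sum0 mulr0 mulr0 /= addr0 mulr_sumr.
apply: eq_bigr => i _; rewrite modn_small ?ltnS// /sqnorm.
move: (1 - z) (X i) (X i.+1) => [a b] [c d] [e f] /=.
ring.
Qed.

End Area.

(** Each squared modulus occurs twice on the left: in two consecutive differences or, for [X n], in
    the last difference and the extra term, which is the closing edge of the polygon. *)
Lemma sum_sqnorm_diff (R : realType) (X : nat -> R[i]) (n : nat) : X 0%N = 0 ->
  \sum_(i < n) sqnorm _ (X i.+1 - X i) + sqnorm _ (X n) =
  2 * (\sum_(i < n) sqnorm _ (X i.+1)
       - \sum_(i < n) complex.Re ((X i)^* * X i.+1)).
Proof.
move=> X0; elim: n => [|n IHn].
  by rewrite !big_ord0 X0 /sqnorm mulr0 /= subr0 mulr0 addr0.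
rewrite !big_ord_recr /=.
have -> : sqnorm _ (X n.+1 - X n) =
  sqnorm _ (X n.+1) + sqnorm _ (X n) - 2 * complex.Re ((X n)^* * X n.+1).
  by rewrite /sqnorm; case: (X n) (X n.+1) => [a b] [c d] /=; ring.
lra.
Qed.

(** Induction on the size: a new last row and column bring one diagonal term and two conjugate
    off-diagonal terms, hence twice a real part. *)
Lemma tridiag_form (R : realType) (a : R) (b : R[i]) (X : nat -> R[i])
    (n : nat) : X 0%N = 0 ->
  \sum_(i < n) \sum_(j < n) (X i.+1)^*
      * (if j == i :> nat then - a%:C
         else if j == i.+1 :> nat then b
         else if i == j.+1 :> nat then b^* else 0) * X j.+1 =
  (2 * (\sum_(i < n) complex.Re (b * ((X i)^* * X i.+1)))
     - a * \sum_(i < n) sqnorm _ (X i.+1))%:C.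
Proof.
move=> X0; elim: n => [|n IHn]; first by rewrite !big_ord0 !mulr0 subr0.
under eq_bigr do rewrite big_ord_recr /=.
rewrite big_split /= !big_ord_recr /= IHn eqxx {IHn}.
(* Above the corner, the new column is nonzero only in its last entry; if it is empty, [X 0 = 0]
   makes the formula hold. *)
have -> : \sum_(i < n) (X i.+1)^*
    * (if n == i :> nat then - a%:C else if n == i.+1 :> nat then b
       else if i == n.+1 :> nat then b^* else 0) * X n.+1
  = (X n)^* * b * X n.+1.
  case: n => [|n]; first by rewrite big_ord0 X0 rmorph0 !mul0r.
  rewrite big_ord_recr /= big1 ?add0r => [|i _]; last first.
    have lin := ltn_ord i.
    by rewrite !ifF ?mulr0 ?mul0r //; lia.
  by rewrite eqxx gtn_eqF.
have -> : \sum_(i < n) (X n.+1)^*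
    * (if i == n :> nat then - a%:C else if i == n.+1 :> nat then b
       else if n == i.+1 :> nat then b^* else 0) * X i.+1
  = (X n.+1)^* * b^* * X n.
  case: n => [|n]; first by rewrite big_ord0 X0 mulr0.
  rewrite big_ord_recr /= big1 ?add0r => [|i _]; last first.
    have lin := ltn_ord i.
    by rewrite !ifF ?mulr0 ?mul0r //; lia.
  by rewrite eqxx !ltn_eqF.
rewrite /sqnorm; move: (\sum_(i < n) _) (\sum_(i < n) _) => S T.
case: b (X n) (X n.+1) => [b b'] [c d] [e f].
by apply/eqP; rewrite eq_complex /=; apply/andP; split; apply/eqP; ring.
Qed.

(** * The area and the matrix in terms of zeta *)

Section Zeta.
Variables (R : realType) (k : nat).
Hypothesis k_gt2 : (2 < k)%N.
Let c := complex.Re (zeta R k).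
Let s := complex.Im (zeta R k).

Lemma Im_zeta_gt0 : 0 < s.
Proof.
have k0 : 0 < k%:R :> R by rewrite ltr0n (ltn_trans _ k_gt2).
rewrite /s /=; apply: sin_gt0_pi.
rewrite divr_gt0 ?mulr_gt0 ?pi_gt0 //= ltr_pdivrMr // [pi * _]mulrC.
by rewrite ltr_pM2r ?pi_gt0 // (ltr_nat R 2).
Qed.

Lemma zeta_norm : c ^+ 2 + s ^+ 2 = 1.
Proof. exact: cos2Dsin2. Qed.

Lemma Im_zeta_epsilon : s%:C * epsilon R k = s / 2 -i* ((1 - c) / 2).
Proof.
have nz : 1 + zeta R k != 0.
  rewrite eq_complex negb_and /= add0r; apply/orP; right.
  by rewrite gt_eqF // Im_zeta_gt0.
apply: (mulIf nz); rewrite /epsilon mulfVK //.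
have := zeta_norm; rewrite /s /c; case: (zeta R k) => x y /= h.
by apply/eqP; rewrite eq_complex /=; apply/andP; split; apply/eqP; lra.
Qed.

Lemma areaE (v : 'cV[R[i]]_(2 * k - 2)) (X := partial_sum _ _ v) :
  area v = (1 - c) * (\sum_(i < 2 * k - 2) complex.Im ((X i)^* * X i.+1))
    + s * (\sum_(i < 2 * k - 2) complex.Re ((X i)^* * X i.+1))
    - s * \sum_(i < 2 * k - 2) sqnorm _ (X i.+1).
Proof.
(* The signed area is negative, since [w] is [- zeta] times [v] and [s > 0]; the absolute value
   flips the sign. *)
have tri (y : R[i]) : triangle_area y (- zeta R k * y) = s / 2 * sqnorm _ y.
  have -> : triangle_area y (- zeta R k * y) = 2^-1 * `|- (s * sqnorm _ y)|.
    rewrite /triangle_area; congr (_ * `|_|); rewrite /sqnorm /s.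
    by case: (zeta R k) y => [a b] [d e] /=; ring.
  rewrite normrN ger0_norm; first by rewrite mulrA [_ * s]mulrC.
  apply: mulr_ge0; first exact/ltW/Im_zeta_gt0.
  by rewrite /sqnorm; case: (y) => d e /=; nra.
rewrite /area signed_areaE -/X.
under [X in _ - X]eq_bigr => j _ do rewrite w_edgeE tri.
rewrite -mulr_sumr big_split_ord /= big_ord1.
under [X in _ - _ * (X + _)]eq_bigr => j _ do rewrite v_edgeE /= ltn_ord.
rewrite v_edgeE /= addn0 ltnn -/X.
have -> y : sqnorm _ (- y) = sqnorm R y by rewrite /sqnorm rmorphN /= mulrNN.
rewrite (sum_sqnorm_diff _ X) ?/X ?partial_sum0 // -/X.
have -> : sqnorm _ (1 - zeta R k) = 2 * (1 - c).
  have := zeta_norm; rewrite /c /s /sqnorm; case: (zeta R k) => x y /= h.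
  lra.
by field.
Qed.

Lemma tridiag_gram_area (v : 'cV[R[i]]_(2 * k - 2)) :
  \sum_i \sum_j (x_coord v i 0)^* * tridiag_gram R k i j * x_coord v j 0 =
  (area v)%:C.
Proof.
pose b := s / 2 -i* ((1 - c) / 2).
pose X := partial_sum _ _ v.
transitivity (\sum_(i < 2 * k - 2) \sum_(j < 2 * k - 2) (X i.+1)^*
      * (if j == i :> nat then - s%:C
         else if j == i.+1 :> nat then b
         else if i == j.+1 :> nat then b^* else 0) * X j.+1).
  apply: eq_bigr => i _; apply: eq_bigr => j _; rewrite !x_coordE !mxE.
  congr (_ * _ * _); rewrite /b -Im_zeta_epsilon rmorphM.
  case: ifP => _; first by rewrite mulrN1.
  case: ifP => _ //; case: ifP => _; last by rewrite mulr0.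
  by congr (_ * _); rewrite -[LHS]conjc_real.
rewrite tridiag_form ?/X ?partial_sum0 // -/X areaE -/X; congr (_%:C).
(* Termwise, [2 * Re (b * y) = (1 - c) * Im y + s * Re y]. *)
congr (_ - _); rewrite !mulr_sumr -big_split /=; apply: eq_bigr => i _.
by case: (X i) (X i.+1) => [d e] [f g] /=; field.
Qed.

End Zeta.

(* Hermitian forms are conjugate-linear in the first variable, hence the
   explicit scaling laws instead of {hermitian_sym _ for _}.  U stands for the
   set of vectors v coming from flat cone spheres; all that matters is that it
   has nonempty interior, which makes A unique.  The type R[i]^o is R[i] with
   its usual topology. *)
Theorem proposition3p1 (R : realType) (k : nat)
    (hk : [\/ k = 6%N, k = 4%N | k = 3%N])
    (A : {bilinear 'cV[R[i]]_(2 * k - 2) -> 'cV[R[i]]_(2 * k - 2) -> R[i]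
          | @conjc R \; *%R & *%R})
    (A_herm : forall u v, A v u = (A u v)^*)
    (U : set 'cV[R[i]^o]_(2 * k - 2))
    (U_int : (interior U !=set0)%classic)
    (A_area : forall v : 'cV[R[i]]_(2 * k - 2), U v -> A v v = (area v)%:C) :
  is_gram_matrix A (@x_coord R (2 * k - 2)) (tridiag_gram R k).
Proof.
have k_gt2 : (2 < k)%N by case: hk => ->.
set n := (2 * k - 2)%N in A A_herm U U_int A_area *.
have xD (u w : 'cV[R[i]]_n) i :
    x_coord (u + w) i 0 = x_coord u i 0 + x_coord w i 0.
  by rewrite !mxE -big_split /=; apply: eq_bigr => j _; rewrite mxE.
have xZ a (u : 'cV[R[i]]_n) i : x_coord (a *: u) i 0 = a * x_coord u i 0.
  by rewrite !mxE mulr_sumr; apply: eq_bigr => j _; rewrite mxE.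
(* The form of the claimed matrix, pulled back along the linear map [x_coord]; [A - B] then vanishes
   on the diagonal over [U]. *)
pose B (u w : 'cV[R[i]]_n) :=
  \sum_i \sum_j (x_coord u i 0)^* * tridiag_gram R k i j * x_coord w j 0.
have BDl u u' w : B (u + u') w = B u w + B u' w.
  rewrite -big_split; apply: eq_bigr => i _; rewrite -big_split.
  by apply: eq_bigr => j _; rewrite xD rmorphD /= !mulrDl.
have BDr u w w' : B u (w + w') = B u w + B u w'.
  rewrite -big_split; apply: eq_bigr => i _; rewrite -big_split.
  by apply: eq_bigr => j _; rewrite xD mulrDr.
have BZl a u w : B (a *: u) w = a^* * B u w.
  rewrite mulr_sumr; apply: eq_bigr => i _; rewrite mulr_sumr.
  by apply: eq_bigr => j _; rewrite xZ rmorphM /= !mulrA.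
have BZr a u w : B u (a *: w) = a * B u w.
  rewrite mulr_sumr; apply: eq_bigr => i _; rewrite mulr_sumr.
  by apply: eq_bigr => j _; rewrite xZ mulrCA.
move=> u w; apply/eqP; rewrite -subr_eq0; apply/eqP.
apply: (@sesquilinear_eq0 R n (fun u w => A u w - B u w) _ _ _ _ U) => //.
- by move=> x x' y; rewrite linearDl BDl opprD addrACA.
- by move=> x y y'; rewrite linearDr BDr opprD addrACA.
- by move=> a x y; rewrite linearZl_LR BZl mulrBr.
- by move=> a x y; rewrite linearZr_LR BZr mulrBr.
- by move=> y /A_area ->; rewrite /B tridiag_gram_area // subrr.
Qed.
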